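(* Let $X$ be a Banach space and let $(T_t)_{t\ge 0}$ be a strongly continuous semigroup of bounded linear operators on $X$. Assume that the following two conditions hold. (I) The set $$D=\{x\in X \mid \forall t>0\ \exists y=y(t)\in X \text{ such that } T_t y=x\}$$ is dense in $X$. (II) $(T_t)$ has the backward uniqueness property: if $T_t x=T_t y$ for some $t>0$ and $x,y\in X$, then $x=y$. Let $$E=\{(z_n)_{n\in\mathbb N} \mid z_n\in D \text{ for all } n,\ \exists t>0 \text{ such that } \lim_{n\to\infty}T_t z_n \text{ exists in } X\}/\sim,$$ where $(z_n)\sim(z_n')$ if and only if, for some $t>0$, both limits $\lim_{n\to\infty}T_t z_n$ and $\lim_{n\to\infty}T_t z_n'$ exist in $X$ and are equal. Then: 1. $X\subset E$, in the sense that sending $x\in X$ to the class of any sequence $(x_n)$ in $D$ with $\lim_{n\to\infty}x_n=x$ in $X$ is a well-defined injective map $\iota:X\to E$. 2. There exists a family of maps $\mathcal T_t:E\to E$ ($t\in\mathbb R$) which is a group, i.e. $\mathcal T_t\mathcal T_s=\mathcal T_{t+s}$ for all $s,t\in\mathbb R$ and $\mathcal T_0=I$ (the identity map of $E$), and which satisfies 3. $\mathcal T_t x=T_t x$ for every $x\in X$ and every $t\in\mathbb R$ for which $T_t x$ exists, i.e. $\mathcal T_t\,\iota(x)=\iota(T_t x)$ for such $x$ and $t$.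
   Context: For $t>0$ and $x\in X$, one says that $T_{-t}x$ exists if there is $y\in X$ with $T_t y=x$; by backward uniqueness this $y$ is unique, and one writes $T_{-t}x=y$. For $t\ge 0$, $T_t x$ exists for all $x\in X$. *)

(* Defs.v *)
(* MathComp-Analysis *)
From HB Require Import structures.
From mathcomp Require Import all_boot all_order all_algebra.
From mathcomp Require Import generic_quotient.
From mathcomp Require Import all_classical all_reals all_analysis.

Set Implicit Arguments.
Unset Strict Implicit.
Unset Printing Implicit Defensive.

Import Order.TTheory GRing.Theory Num.Theory.
Import numFieldNormedType.Exports.

Local Open Scope classical_set_scope.
Local Open Scope ring_scope.
Local Open Scope quotient_scope.

(* Times live in [R], scalars in [K], so that real ([K := R]) and complex
   ([K := R[i]]) Banach spaces are treated at once; [K] is to be used with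
   [Num.archimedean_axiom K], which both choices satisfy and without which the
   norm topology need not be first countable. The index set of the semigroup is
   [0, +oo[: the operators [T t] with [t < 0] are junk (for
   instance [0]) and never enter the definitions below. *)
Record c0_semigroup (R : realType) (K : numFieldType)
    (X : completeNormedModType K) := C0Semigroup {
  c0_op :> R -> {linear X -> X};
  c0_bounded : forall t, 0 <= t -> bounded_near (c0_op t) (nbhs (0 : X));
  c0_op0 : forall x, c0_op 0 x = x;
  c0_opD : forall s t x, 0 <= s -> 0 <= t ->
    c0_op (s + t) x = c0_op s (c0_op t x);
  c0_strongly_continuous : forall x, c0_op t x @[t --> 0^'+] --> x
}.

Arguments c0_semigroup R {K} X.

Section C0Semigroup.
Context {R : realType} {K : numFieldType} {X : completeNormedModType K}.
Variable T : c0_semigroup R X.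

Definition Dset : set X := [set x | forall t : R, 0 < t -> exists y : X, T t y = x].

Definition backward_uniqueness :=
  forall (t : R) (x y : X), 0 < t -> T t x = T t y -> x = y.

(* [op_value t x y] reads "[T_t x] exists and equals [y]", for any real [t]. *)
Definition op_value (t : R) (x y : X) :=
  if 0 <= t then T t x = y else T (- t) y = x.

Definition Eseq : set (nat -> X) :=
  [set z | (forall n, Dset (z n)) /\
           exists2 t : R, 0 < t & cvg (T t (z n) @[n --> \oo])].

Definition Eequiv (z z' : Eseq) : bool :=
  `[< exists2 t : R, 0 < t & exists l : X,
        (T t (val z n) @[n --> \oo] --> l) /\
        (T t (val z' n) @[n --> \oo] --> l) >].

Let c0_shift (z : nat -> X) s t l : 0 <= s -> 0 <= t ->
  T t (z n) @[n --> \oo] --> l -> T (s + t) (z n) @[n --> \oo] --> T s l.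
Proof.
move=> s0 t0 zl; under eq_fun do rewrite c0_opD//.
have Tsc := bounded_linear_continuous (c0_bounded T s0).
exact: (cvg_comp _ _ zl (Tsc l)).
Qed.

Let Eequiv_refl : reflexive Eequiv.
Proof.
move=> z; apply/asboolP; have /set_mem[_ [t t0 /cvg_ex[l zl]]] := valP z.
by exists t => //; exists l.
Qed.

Let Eequiv_sym : symmetric Eequiv.
Proof.
by move=> z z'; apply/idP/idP => /asboolP[t t0 [l [h h']]];
  apply/asboolP; exists t => //; exists l.
Qed.

Let Eequiv_trans : transitive Eequiv.
Proof.
move=> b a c /asboolP[t t0 [l [al bl]]] /asboolP[s s0 [m [bm cm]]].
apply/asboolP; exists (s + t); first by rewrite addr_gt0.
have bl' := c0_shift (ltW s0) (ltW t0) bl.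
have := c0_shift (ltW t0) (ltW s0) bm; rewrite addrC => bm'.
have lm : T s l = T t m by exact: (cvg_unique (@norm_hausdorff _ X) bl' bm').
exists (T s l); split; first exact: c0_shift (ltW s0) (ltW t0) al.
by rewrite lm addrC; apply: c0_shift (ltW t0) (ltW s0) cm.
Qed.

Canonical Eequiv_equiv :=
  EquivRel Eequiv Eequiv_refl Eequiv_sym Eequiv_trans.

Definition E : Type := {eq_quot Eequiv}.
HB.instance Definition _ := Choice.on E.
HB.instance Definition _ := EqQuotient.on E.

End C0Semigroup.

(* Main.v *)
(* By backward uniqueness each T_t, t >= 0, is injective, and on D it has an
   inverse with values in D, so (T_t) extends to a group on D. Applying this
   group termwise to sequences in D respects ~: if T_s z_n -> l then
   T_(|t|+s) (T_t z_n) = T_(|t|+t) (T_s z_n) -> T_(|t|+t) l, where now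
   |t|+t >= 0. The map X -> E is injective since each T_t is, and it is defined
   everywhere since D is dense. *)
Require Import Defs.
From HB Require Import structures.
From mathcomp Require Import all_boot all_order all_algebra.
From mathcomp Require Import generic_quotient.
From mathcomp Require Import lra.
From mathcomp Require Import all_classical all_reals all_analysis.

Set Implicit Arguments.
Unset Strict Implicit.
Unset Printing Implicit Defensive.

Import Order.TTheory GRing.Theory Num.Theory.
Import numFieldNormedType.Exports.

Local Open Scope classical_set_scope.
Local Open Scope ring_scope.
Local Open Scope quotient_scope.

Section Extension.
Context {R : realType} {K : numFieldType} {X : completeNormedModType K}.
Variable T : c0_semigroup R X.

Lemma c0_cvg (t : R) (z : nat -> X) (x : X) : 0 <= t ->
  z n @[n --> \oo] --> x -> T t (z n) @[n --> \oo] --> T t x.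
Proof.
move=> t0 zx; have Tc := bounded_linear_continuous (c0_bounded T t0).
exact: (cvg_comp _ _ zx (Tc x)).
Qed.

Lemma c0_comm (s t : R) (x : X) : 0 <= s -> 0 <= t ->
  T s (T t x) = T t (T s x).
Proof. by move=> s0 t0; rewrite -!c0_opD// addrC. Qed.

(** The balls of radius [1/(n+1)] around [x] meet [A]. Over an Archimedean [K] these radii drop
    below every positive [e], so points chosen in them converge to [x]. *)
Lemma dense_cvg_seq (A : set X) (x : X) : Num.archimedean_axiom K -> dense A ->
  exists z : nat -> X, (forall n, A (z n)) /\ z n @[n --> \oo] --> x.
Proof.
move=> K_archi dA.
have ballA n : exists y, A y /\ ball x (n.+1%:R^-1 : K) y.
  have e0 : 0 < (n.+1%:R^-1 : K) by rewrite invr_gt0 ltr0Sn.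
  have [||y [/interior_subset By Ay]] := dA (interior (ball x (n.+1%:R^-1 : K))).
  - by exists x; exact: nbhsx_ballx.
  - exact: open_interior.
  by exists y.
have [z zP] := choice ballA.
exists z; split => [n|]; first by case: (zP n).
apply/cvg_ballP => e e0.
have [m em] := K_archi e^-1.
exists m => // n /= mn; have [_] := zP n; apply: le_ball.
rewrite -[e]invrK lef_pV2 ?posrE ?invr_gt0 ?ltr0Sn//.
move: em; rewrite gtr0_norm ?invr_gt0// => /ltW /le_trans; apply.
by rewrite ler_nat (leq_trans mn).
Qed.

Lemma eclassP (u v : Eseq T) :
  \pi_(E T) u = \pi_(E T) v <->
  exists2 t : R, 0 < t & exists l : X,
    (T t (val u n) @[n --> \oo] --> l) /\
    (T t (val v n) @[n --> \oo] --> l).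
Proof. by split=> [/eqquotP/asboolP|h]; last exact/eqquotP/asboolP. Qed.

Lemma Eseq_cvg (z : nat -> X) (x : X) :
  (forall n, Dset T (z n)) -> z n @[n --> \oo] --> x -> Eseq T z.
Proof.
move=> zD zx; split => //; exists 1; first exact: ltr01.
by apply/cvg_ex; exists (T 1 x); exact: c0_cvg.
Qed.

Definition eseq (z : nat -> X) (zE : Eseq T z) : Eseq T := exist _ z (mem_set zE).

Hypothesis T_bu : backward_uniqueness T.

Lemma c0_inj (t : R) : 0 <= t -> injective (T t).
Proof.
rewrite le_eqVlt => /predU1P[<- x y|t0 x y]; last exact: T_bu.
by rewrite !c0_op0.
Qed.

(* Two-sided in the sign of [t]: "[y] is [T_t z]" after applying a large enough
   [T_a] to both sides, so that the group law needs no case split on signs. *)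
Definition shifted (t : R) (z y : X) :=
  exists a, [/\ 0 <= a, 0 <= a + t & T a y = T (a + t) z].

(** The witness [b] may be traded for any admissible [a]: applying the injective [T b] turns both
    sides into [T (a + b + t) z]. *)
Lemma shiftedE (t a : R) (z y : X) : shifted t z y -> 0 <= a -> 0 <= a + t ->
  T a y = T (a + t) z.
Proof.
move=> [b [b0 bt0 yz]] a0 at0; apply: (c0_inj b0).
by rewrite c0_comm// yz -!c0_opD// addrCA.
Qed.

Lemma shifted_uniq (t : R) (z y y' : X) :
  shifted t z y -> shifted t z y' -> y = y'.
Proof.
by move=> [a [a0 at0 yz]] y'z; apply: (c0_inj a0); rewrite yz (shiftedE y'z).
Qed.

Lemma shifted0 (z : X) : shifted 0 z z.
Proof. by exists 0; rewrite addr0. Qed.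

Lemma shiftedD (s t : R) (x y z : X) :
  shifted s x y -> shifted t y z -> shifted (t + s) x z.
Proof.
move=> xy yz; have sn := ler_norm (- s); have tn := ler_norm (- t).
have s1 := normr_ge0 (- s); have t1 := normr_ge0 (- t).
(* This time stays nonnegative after adding [t], and then also [s], so [shiftedE] applies to both
   shifts in turn. *)
exists (`|- s| + `|- t|); split; [lra|lra|].
by rewrite (shiftedE yz) ?(shiftedE xy) ?addrA//; lra.
Qed.

Lemma shifted_op (t : R) (z : X) : 0 <= t -> shifted t z (T t z).
Proof. by move=> t0; exists 0; rewrite add0r c0_op0. Qed.

Lemma shifted_op_opp (t : R) (z : X) : 0 <= t -> shifted (- t) (T t z) z.
Proof. by move=> t0; exists t; rewrite subrr c0_op0. Qed.

Lemma shifted_ex (t : R) (z : X) :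
  Dset T z -> exists y, Dset T y /\ shifted t z y.
Proof.
move=> zD; have [t0|t0] := leP 0 t.
  exists (T t z); split; last exact: shifted_op.
  move=> s s0; have [w <-] := zD s s0; exists (T t w).
  by rewrite c0_comm// ltW.
have nt0 : 0 < - t by rewrite oppr_gt0.
have [y yz] := zD _ nt0; exists y; split; last first.
  by rewrite -[t]opprK -yz; exact/shifted_op_opp/ltW.
(* [y] inherits membership in [D]: a preimage [w] of [z] under [T (- t + s)] satisfies [T s w = y],
   since [T (- t)] is injective. *)
move=> s s0; have [w wz] := zD _ (addr_gt0 nt0 s0); exists w.
by apply: (T_bu nt0); rewrite yz -wz c0_opD// ltW.
Qed.

(** The new time and limit depend only on [t], [s] and [l], so two sequences sharing a time and a
    limit still share both after the shift. *)
Lemma shifted_cvg (t s : R) (z y : nat -> X) (l : X) : 0 <= s ->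
  (forall n, shifted t (z n) (y n)) -> T s (z n) @[n --> \oo] --> l ->
  T (`|t| + s) (y n) @[n --> \oo] --> T (`|t| + t) l.
Proof.
move=> s0 zy zl.
have t0 : 0 <= `|t| + t by have := ler_norm (- t); rewrite normrN; lra.
have yE n : T (`|t| + s) (y n) = T (`|t| + t) (T s (z n)).
  rewrite (shiftedE (zy n)); [|by rewrite addr_ge0|by rewrite addrAC addr_ge0].
  by rewrite addrAC c0_opD.
under eq_fun do rewrite yE.
exact: c0_cvg.
Qed.

Lemma shifted_Eseq (t : R) (u : Eseq T) :
  exists v : Eseq T, forall n, shifted t (val u n) (val v n).
Proof.
have /set_mem[uD [s s0 /cvg_ex[l ul]]] := valP u.
have [y yP] := choice (fun n => shifted_ex t (uD n)).
have yE : Eseq T y.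
  split=> [n|]; first by case: (yP n).
  exists (`|t| + s); first by rewrite ltr_wpDl.
  apply/cvg_ex; exists (T (`|t| + t) l).
  by apply: shifted_cvg ul => [|n]; [exact: ltW|case: (yP n)].
by exists (eseq yE) => n; case: (yP n).
Qed.

Lemma shifted_class (t : R) (u u' v v' : Eseq T) :
  (forall n, shifted t (val u n) (val v n)) ->
  (forall n, shifted t (val u' n) (val v' n)) ->
  \pi_(E T) u = \pi_(E T) u' -> \pi_(E T) v = \pi_(E T) v'.
Proof.
move=> uv u'v' /eclassP[s s0 [l [ul u'l]]]; apply/eclassP.
exists (`|t| + s); first by rewrite ltr_wpDl.
by exists (T (`|t| + t) l); split; apply: shifted_cvg; eauto; exact: ltW.
Qed.

(** Continuity of [T t] forces the common limit to be both [T t x] and [T t y]. One direction gives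
    injectivity of the embedding of [X], the other its independence of the approximating
    sequence. *)
Lemma cvg_class (x y : X) (u v : Eseq T) :
  val u n @[n --> \oo] --> x -> val v n @[n --> \oo] --> y ->
  \pi_(E T) u = \pi_(E T) v <-> x = y.
Proof.
move=> ux vy; split=> [/eclassP[t t0 [l [ul vl]]]|xy].
  apply: (T_bu t0).
  rewrite (cvg_unique (@norm_hausdorff _ X) (c0_cvg (ltW t0) ux) ul).
  exact: (cvg_unique (@norm_hausdorff _ X) vl (c0_cvg (ltW t0) vy)).
apply/eclassP; exists 1; first exact: ltr01.
by exists (T 1 x); split; [|rewrite xy]; exact: c0_cvg.
Qed.

End Extension.

Theorem theorem1 (R : realType) (K : numFieldType)
    (K_archi : Num.archimedean_axiom K)
    (X : completeNormedModType K) (T : c0_semigroup R X)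
    (D_dense : dense (Dset T)) (T_bu : backward_uniqueness T) :
  exists iota : X -> E T,
    [/\ (forall x : X, exists z : nat -> X,
           (forall n, Dset T (z n)) /\ (z n @[n --> \oo] --> x)),
        (forall (x : X) (z : nat -> X),
           (forall n, Dset T (z n)) -> z n @[n --> \oo] --> x ->
           exists2 e : Eseq T, val e = z & iota x = \pi_(E T) e),
        injective iota &
        exists TT : R -> E T -> E T,
          [/\ (forall s t : R, TT t \o TT s = TT (t + s)),
              TT 0 = id &
              (forall (x y : X) (t : R),
                 op_value T t x y -> TT t (iota x) = iota y)]].
Proof.
have approx (x : X) : exists e : Eseq T, val e n @[n --> \oo] --> x.
  have [z [zD zx]] := dense_cvg_seq x K_archi D_dense.
  by exists (eseq (Eseq_cvg zD zx)).
have [e eP] := choice approx.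
pose iota x := \pi_(E T) (e x).
have iotaP x (u : Eseq T) : val u n @[n --> \oo] --> x -> iota x = \pi_(E T) u.
  by move=> ux; apply/(cvg_class T_bu (eP x) ux).
have [S SP] := choice (fun tu : R * Eseq T => shifted_Eseq T_bu tu.1 tu.2).
pose TT t (c : E T) := \pi_(E T) (S (t, repr c)).
(* [TT t] can be computed with any representative and any termwise shift of it; each remaining claim
   about [TT] reduces to exhibiting one. *)
have TTP t (u v : Eseq T) : (forall n, shifted T t (val u n) (val v n)) ->
    TT t (\pi_(E T) u) = \pi_(E T) v.
  move=> uv; apply: (shifted_class T_bu (SP (t, _)) uv).
  by rewrite reprK.
exists iota; split.
- by move=> x; exact: dense_cvg_seq.
- move=> x z zD zx; exists (eseq (Eseq_cvg zD zx)) => //.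
  exact: iotaP.
- by move=> x y /(cvg_class T_bu (eP x) (eP y)).
exists TT; split.
- move=> s t; apply/funext => c /=; rewrite -[c]reprK; set u := repr c.
  rewrite (TTP _ _ _ (SP (s, u))) (TTP _ _ _ (SP (t, _))).
  symmetry; apply: TTP => n.
  exact: (shiftedD T_bu (SP (s, _) n) (SP (t, _) n)).
- apply/funext => c /=; rewrite -[c]reprK; apply: TTP => n.
  exact: shifted0.
move=> x y t; rewrite /op_value; case: leP => t0.
- move=> <-; rewrite {1}/iota (TTP _ _ _ (SP (t, e x))); symmetry; apply: iotaP.
  rewrite [X in X @ _](_ : _ = fun n => T t (val (e x) n)); last first.
    apply/funext => n; apply: (shifted_uniq T_bu (SP (t, e x) n)).
    exact: shifted_op.
  exact: (c0_cvg t0).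
(* For [t < 0] the shift of an arbitrary sequence tending to [x] need not converge in [X]. So
   [x = T (- t) y] is approximated by [T (- t)] of the sequence chosen for [y], and shifting by [t]
   gives that sequence back. *)
move=> <-; have nt0 : 0 <= - t by rewrite oppr_ge0 ltW.
set v := S (- t, e y).
have vE n : T (- t) (val (e y) n) = val v n.
  apply: (shifted_uniq T_bu) (SP (- t, e y) n); exact: shifted_op.
rewrite (iotaP _ v); last first.
  by under eq_fun do rewrite -vE; exact: c0_cvg.
by apply: TTP => n; rewrite -vE -[X in shifted _ X]opprK; exact: shifted_op_opp.
Qed.
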